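(* Let $D\ge 0$ be an integer, let $0<s<2$, and let $a$ be a non-zero finitely supported real sequence with zero sum. If the order $M(a)$ of $a$ satisfies $M(a)>D$, then $$\sum_j a^{2*}_j|j|^{2D+s}\neq 0,$$ more precisely $$(-1)^D\sum_j a^{2*}_j|j|^{2D+s}<0.$$
   Context: A sequence $a$ is written $(a_0,\dots,a_{L-1})$ with $a_0\neq 0$, $a_{L-1}\ne 0$. Its order $M(a)$ is the integer such that $\sum_j a_j j^k=0$ for $0\le k<M(a)$ and $\sum_j a_j j^{M(a)}\neq 0$. The sequence $a^{2*}$, indexed by $\mathbb{Z}$, is defined by $a^{2*}_j=\sum_{k-l=j}a_k a_l$. *)

(* Defs.v *)
From HB Require Import structures.
From mathcomp Require Import all_boot all_order all_algebra.
From mathcomp Require Import all_classical all_reals all_analysis.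

Set Implicit Arguments.
Unset Strict Implicit.
Unset Printing Implicit Defensive.

Import Order.TTheory GRing.Theory Num.Theory.

Local Open Scope classical_set_scope.
Local Open Scope ring_scope.

(* A finitely supported sequence (a_0, ..., a_{L-1}) is a function int -> R,  *)
(* extended by zero. Sums over int or int * int are the [fsbig] sums          *)
(* \sum_(i \in A) F i, whose value is the junk 0 when F has infinitely many   *)
(* nonzero terms in A; all of them are genuine finite sums if a is finitely   *)
(* supported.                                                                 *)
Definition finitely_supported (R : realType) (a : int -> R) : Prop :=
  finite_set [set j | a j != 0].

Definition moment (R : realType) (a : int -> R) (k : nat) : R :=
  \sum_(j \in [set: int]) a j * j%:~R ^+ k.

(* [has_order a M] reads "M(a) = M": such an M is unique, and exists whenever *)
(* a is nonzero and finitely supported.                                       *)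
Definition has_order (R : realType) (a : int -> R) (M : nat) : Prop :=
  (forall k : nat, (k < M)%N -> moment a k = 0) /\ moment a M <> 0.

(* a^{2*} *)
Definition autocorrelation (R : realType) (a : int -> R) (j : int) : R :=
  \sum_(p \in [set p : int * int | p.1 - p.2 = j]) a p.1 * a p.2.

(* Main.v *)
Require Import Defs.
From HB Require Import structures.
From mathcomp Require Import all_boot all_order all_algebra.
From mathcomp Require Import all_classical all_reals all_analysis.
From mathcomp Require Import ring lra zify.

Set Implicit Arguments.
Unset Strict Implicit.
Unset Printing Implicit Defensive.

Import Order.TTheory GRing.Theory Num.Theory.
Import numFieldNormedType.Exports.

Local Open Scope classical_set_scope.
Local Open Scope ring_scope.

(* Write Q(p, x) = sum_{k,l} a_k a_l ((k - l)^2 + x)^p and b = D + s/2, so that the sum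
   in question is Q(b, 0), and dQ(p, x)/dx = p Q(p - 1, x). The vanishing moments of a kill
   sum_{k,l} a_k a_l (k - l)^(2i) for i <= D, hence Q(p, x) -> 0 as x -> oo for every
   p < D + 1. The exponent b - D - 1 lies in (-1, 0), where the kernel is positive
   semidefinite and Q blows up to +oo at x = 0 because of the diagonal terms. Integrating
   D + 1 times from infinity, each step changing the sign, gives (-1)^(D+1) Q(b, x) >= 0
   for x > 0, strictly near 0, and this function is nonincreasing in x. *)

(** * Derivatives, the mean value theorem and monotonicity for real powers *)

Section RealFunctions.
Variable R : realType.
Implicit Types (p x y d : R).

Lemma is_derive_big_sum (I : Type) (r : seq I) (f : I -> R -> R) (df : I -> R) x :
  (forall i, is_derive x 1 (f i) (df i)) ->
  is_derive x 1 (fun z => \sum_(i <- r) f i z) (\sum_(i <- r) df i).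
Proof.
move=> fdf; elim: r => [|i r IHr].
  rewrite big_nil (_ : (fun _ => _) = cst 0); first exact: is_derive_cst.
  by apply/funext => z; rewrite big_nil.
rewrite big_cons (_ : (fun _ => _) = f i + (fun z => \sum_(j <- r) f j z)).
  exact: is_deriveD.
by apply/funext => z; rewrite big_cons.
Qed.

Lemma is_derive_powR_affine p t y d : 0 < t * y + d ->
  is_derive t 1 (fun z => (z * y + d) `^ p) (p * (t * y + d) `^ (p - 1) * y).
Proof.
move=> h.
have := @is_derive1_comp _ (fun u => u `^ p) (fun z => z * y + d) t
  (p * (t * y + d) `^ (p - 1)) y; apply; first exact: is_derive1_powR.
rewrite (_ : (fun _ => _) = y *: id + cst d); last first.
  by apply/funext => z; rewrite mulrC.
by apply: is_derive_eq; rewrite addr0 /GRing.scale /= mulr1.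
Qed.

Lemma MVT_derivable (f df : R -> R) a b : a <= b ->
  (forall x, a <= x <= b -> is_derive x 1 f (df x)) ->
  exists2 c, a <= c <= b & f b - f a = df c * (b - a).
Proof.
move=> ab fdf; have [||c cab ->] := @MVT_segment R f df a b ab.
- by move=> x /[!in_itv]/= /andP[/ltW ax /ltW xb]; apply: fdf; rewrite ax xb.
- apply: derivable_within_continuous => x /[!in_itv]/= xab.
  by have [] := fdf x xab.
- by exists c => //; move: cab; rewrite in_itv.
Qed.

Lemma ler_powRn p x y : p <= 0 -> 0 < x -> x <= y -> y `^ p <= x `^ p.
Proof.
move=> p0 x0 xy; have y0 : 0 < y by apply: lt_le_trans xy.
have [q q0 ->] : exists2 q, 0 <= q & p = - q.
  by exists (- p); rewrite ?oppr_ge0 ?opprK.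
rewrite !powRN lef_pV2 ?posrE ?powR_gt0//.
by rewrite (@ge0_ler_powR _ q)// nnegrE ltW.
Qed.

End RealFunctions.

(** * Decay at infinity of sums of shifted powers with vanishing moments *)

Section ShiftedPowers.
Variables (R : realType) (I : Type) (r : seq I) (y : I -> R).
Hypothesis y_ge0 : forall i, 0 <= y i.

Lemma shifted_powers_bound n (c : I -> R) (p : R) :
  (forall k, (k < n)%N -> \sum_(i <- r) c i * y i ^+ k = 0) -> p <= n%:R ->
  exists C : R, forall t d : R, 0 <= t <= 1 -> 0 < d ->
    `|\sum_(i <- r) c i * (t * y i + d) `^ p| <= C * d `^ (p - n%:R).
Proof.
elim: n c p => [|n IHn] c p c0 pn.
  exists (\sum_(i <- r) `|c i|) => t d /andP[t0 t1] d0.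
  rewrite subr0 mulr_suml; apply: le_trans (ler_norm_sum _ _ _) _.
  apply: ler_sum => i _; rewrite normrM ler_wpM2l// ger0_norm ?powR_ge0//.
  by apply: ler_powRn => //; rewrite lerDr mulr_ge0.
have [C hC] : exists C : R, forall t d : R, 0 <= t <= 1 -> 0 < d ->
    `|\sum_(i <- r) (c i * y i) * (t * y i + d) `^ (p - 1)|
      <= C * d `^ (p - 1 - n%:R).
  apply: IHn => [k kn|]; last by rewrite lerBlDr natr1.
  by rewrite -[RHS](c0 k.+1)//; apply: eq_bigr => i _; rewrite exprS mulrA.
exists (`|p| * C) => t d /andP[t0 t1] d0.
pose f z := \sum_(i <- r) c i * (z * y i + d) `^ p.
pose df z := p * \sum_(i <- r) (c i * y i) * (z * y i + d) `^ (p - 1).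
have fE : f 0 = 0.
  rewrite /f; under eq_bigr do rewrite mul0r add0r.
  by rewrite -mulr_suml -[X in X * _](_ : 0 = _) ?mul0r// -[LHS](c0 0)//;
    apply: eq_bigr => i _; rewrite expr0 mulr1.
have [|u /andP[u0 ut]] := @MVT_derivable R f df 0 t t0.
  move=> x /andP[x0 xt]; rewrite /f /df mulr_sumr.
  apply: is_derive_big_sum => i.
  rewrite (_ : (fun _ => _) = c i *: (fun z => (z * y i + d) `^ p))//.
  apply: is_derive_eq.
    apply: is_deriveZ; apply: is_derive_powR_affine.
    by rewrite ltr_wpDl// mulr_ge0.
  by rewrite /GRing.scale /=; ring.
rewrite fE !subr0 -/(f t) => ->; rewrite !normrM -mulrA -mulrA ler_wpM2l//.
have /hC/(_ d0) h : 0 <= u <= 1 by rewrite u0 (le_trans ut).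
rewrite -subr_ge0 in h; rewrite (_ : p - n.+1%:R = p - 1 - n%:R); last first.
  by rewrite -natr1; ring.
rewrite (ger0_norm t0) -subr_ge0; move: h.
set A := `|_|; set B := C * _ => h; have : 0 <= A by exact: normr_ge0.
by move=> A0; nra.
Qed.

Lemma shifted_powers_cvg0 n (c : I -> R) (p : R) :
  (forall k, (k < n)%N -> \sum_(i <- r) c i * y i ^+ k = 0) -> p < n%:R ->
  forall e : R, 0 < e -> exists2 M : R, 0 < M & forall d : R, M <= d ->
    `|\sum_(i <- r) c i * (y i + d) `^ p| <= e.
Proof.
move=> c0 pn e e0; have [C hC] := shifted_powers_bound c0 (ltW pn).
pose q := n%:R - p; have q0 : 0 < q by rewrite subr_gt0.
pose K := `|C| / e + 1; have K0 : 0 < K.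
  by rewrite ltr_wpDl// divr_ge0// ltW.
(* Beyond this threshold [d]^ q >= K > |C| / e[, which makes the bound]C * d [^ (- q)] at most
   [e]. *)
exists (K `^ q^-1) => [|d Md]; first exact: powR_gt0.
have d0 : 0 < d by apply: lt_le_trans Md; exact: powR_gt0.
have := hC 1 d; under eq_bigr do rewrite mul1r.
move=> /(_ _ d0); rewrite ler01 lexx => /(_ isT)/le_trans; apply.
apply: le_trans (ler_wpM2r (powR_ge0 _ _) (ler_norm C)) _.
rewrite (_ : p - n%:R = - q); last by rewrite /q opprB.
rewrite powRN ler_pdivrMr ?powR_gt0// mulrC -ler_pdivrMr//.
have : K <= d `^ q.
  rewrite -[leLHS]powRr1 ?(ltW K0)// -(mulVf (lt0r_neq0 q0)) powRrM.
  by rewrite (@ge0_ler_powR _ q) ?nnegrE ?powR_ge0 ?(ltW q0) ?(ltW d0).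
by apply: le_trans; rewrite /K lerDl.
Qed.

End ShiftedPowers.

Section BinomialSeries.
Variable R : realType.

Lemma cvg_natr_mulX (r : R) : 0 <= r < 1 -> (n%:R * r ^+ n) @[n --> \oo] --> (0 : R).
Proof.
move=> /andP[r0 r1]; pose q := Num.sqrt r.
have q0 : 0 <= q by exact: sqrtr_ge0.
have qr : q ^+ 2 = r by rewrite sqr_sqrtr.
have q1 : q < 1 by rewrite -(ltr_pXn2r (n := 2))// ?nnegrE// qr expr1n.
(* After division by [1 - q] this says that [n] copies of [q ^+ n] are at most the geometric sum of
   the larger powers. One factor [q ^+ n] of [r ^+ n] thus absorbs [n], and the other tends to 0. *)
have nq n : n%:R * q ^+ n * (1 - q) <= 1 - q ^+ n.
  elim: n => [|n IHn]; first by rewrite mul0r mul0r expr0 subrr.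
  have qn0 : 0 <= q ^+ n by exact: exprn_ge0.
  have qn1 : q ^+ n <= 1 by rewrite exprn_ile1// ltW.
  have h1 := ler_wpM2l q0 IHn.
  have h2 : 0 <= (1 - q) * (1 - q ^+ n.+1).
    by rewrite mulr_ge0 ?subr_ge0 ?exprn_ile1// ltW.
  move: h1 h2; rewrite -natr1 exprS; set a := n%:R; set u := q ^+ n => h1 h2.
  by rewrite -subr_ge0; move: h1; rewrite -subr_ge0 => h1; lra.
have le_nr n : 0 <= n%:R * r ^+ n <= (1 - q)^-1 * q ^+ n.
  rewrite mulr_ge0 ?exprn_ge0//= -qr exprAC expr2 mulrA ler_wpM2r ?exprn_ge0//.
  rewrite -[leRHS]mul1r ler_pdivlMr ?subr_gt0//.
  by apply: le_trans (nq n) _; rewrite lerBlDr lerDl exprn_ge0.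
apply: (squeeze_cvgr (f := cst 0) (h := fun n => (1 - q)^-1 * q ^+ n)).
- by near=> n; exact: le_nr.
- exact: cvg_cst.
- rewrite -[X in _ --> X](mulr0 (1 - q)^-1); apply: cvgM; first exact: cvg_cst.
  by apply: cvg_expr; rewrite ger0_norm.
Unshelve. all: by end_near. Qed.

Variable g : R.

Fixpoint binom_coef (n : nat) : R :=
  if n is n'.+1 then binom_coef n' * ((g + n'%:R) / n'.+1%:R) else 1.

Hypothesis g01 : 0 < g < 1.

Lemma binom_coef_itv n : 0 <= binom_coef n <= 1.
Proof.
have /andP[g0 g1] := g01; elim: n => [|n /andP[c0 c1]] /=; first by rewrite ler01 lexx.
rewrite mulr_ge0 ?divr_ge0 ?addr_ge0 ?(ltW g0)//=.
by rewrite mulr_ile1 ?divr_ge0 ?addr_ge0 ?(ltW g0)// ler_pdivrMr// mul1r -natr1 addrC lerD2l ltW.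
Qed.

Definition binom_psum (n : nat) (z : R) := \sum_(0 <= i < n) binom_coef i * z ^+ i.
Definition binom_dpsum (n : nat) (z : R) :=
  \sum_(0 <= i < n) binom_coef i * (i%:R * z ^+ i.-1).

Lemma binom_ode n (z : R) : (1 - z) * binom_dpsum n z =
  g * binom_psum n z - n%:R * binom_coef n * z ^+ n.-1.
Proof.
elim: n => [|n IHn].
  by rewrite /binom_dpsum /binom_psum !big_geq// !mulr0 mul0r mul0r subr0.
rewrite /binom_dpsum /binom_psum !big_nat_recr//= -/(binom_dpsum n z) -/(binom_psum n z).
rewrite mulrDr IHn.
have -> : n.+1%:R * (binom_coef n * ((g + n%:R) / n.+1%:R)) = binom_coef n * (g + n%:R).
  by rewrite [RHS]mulrC; field.
have nz : n%:R * z ^+ n = n%:R * z ^+ n.-1 * z.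
  by case: n {IHn} => [|n]; rewrite ?mul0r// exprSr mulrA.
transitivity (g * binom_psum n z - binom_coef n * (n%:R * z ^+ n.-1 * z)); first by ring.
by rewrite -nz; ring.
Qed.

Lemma cvg_binom_series (z : R) : `|z| < 1 ->
  binom_psum n z @[n --> \oo] --> (1 - z) `^ (- g).
Proof.
move=> z1; have /andP[g0 g1] := g01.
have /andP[z1N z1P] : -1 < z < 1 by rewrite -ltr_norml.
have z1' : 0 < 1 - z by lra.
have tz_le t : 0 <= t <= 1 -> `|t * z| <= `|z|.
  by move=> /andP[t0 t1]; rewrite normrM (ger0_norm t0) ler_piMl.
have tz_gt t : 0 <= t <= 1 -> 0 < t * - z + 1.
  move=> /tz_le tz; have := ler_norm (t * z); rewrite mulrN; lra.
(* By the differential equation this product is nearly constant on the segment from 0 to [z], and it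
   equals 1 at 0. *)
suff h : (binom_psum n z * (1 - z) `^ g) @[n --> \oo] --> (1 : R).
  rewrite (_ : (fun _ => _) =
      (fun n => binom_psum n z * (1 - z) `^ g * (1 - z) `^ (- g))).
    by rewrite -[X in _ --> X]mul1r; apply: cvgM => //; exact: cvg_cst.
  apply/funext => n.
  by rewrite -mulrA -powRD ?subrr ?powRr0 ?mulr1// (gt_eqF z1') implybT.
pose K := (1 - `|z|) `^ (g - 1).
apply: (@cvg_zero _ R^o).
apply/norm_cvg0P.
apply: (squeeze_cvgr (f := cst 0) (h := fun n => K * (n%:R * `|z| ^+ n))); last 2 first.
- exact: cvg_cst.
- rewrite -[X in _ --> X](mulr0 K); apply: cvgM; first exact: cvg_cst.
  by apply: cvg_natr_mulX; rewrite normr_ge0.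
near=> n; rewrite /= normr_ge0 /=.
pose f t := binom_psum n (t * z) * (t * - z + 1) `^ g.
pose df t := - ((t * - z + 1) `^ (g - 1) * (n%:R * binom_coef n * (t * z) ^+ n.-1) * z).
have [|t t01] := @MVT_derivable R f df 0 1 ler01.
  move=> t /tz_gt tz0.
  have dS : is_derive t 1 (fun t => binom_psum n (t * z)) (z * binom_dpsum n (t * z)).
    rewrite /binom_psum /binom_dpsum mulr_sumr.
    apply: is_derive_big_sum => i.
    rewrite (_ : (fun _ => _) = (binom_coef i * z ^+ i) *: (id ^+ i)).
      apply: is_derive_eq.
      rewrite /GRing.scale /= mulr1.
      case: i => [|i] /=; first by rewrite !(mul0r, mulr0).
      by rewrite exprMn exprS; ring.
    by apply/funext => u; rewrite exprMn !fctE /= /GRing.scale /=; ring.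
  have dP := is_derive_powR_affine g tz0.
  rewrite (_ : f = (fun t => binom_psum n (t * z)) * (fun t => (t * - z + 1) `^ g))//.
  apply: is_derive_eq.
  have := binom_ode n (t * z); rewrite /df /GRing.scale /=.
  rewrite -(@mulr_powRB1 _ (t * - z + 1) g) ?(ltW tz0)//.
  move: (_ `^ _) (binom_psum _ _) (binom_dpsum _ _) ((_ * z) ^+ _) => u S S' w ode.
  transitivity (u * z * ((1 - t * z) * S' - g * S)); first by ring.
  by rewrite ode; ring.
have -> : f 1 = binom_psum n z * (1 - z) `^ g.
  by rewrite /f !mul1r addrC.
have n0 : (0 < n)%N by near: n; exact: nbhs_infty_gt.
have -> : f 0 = 1.
  rewrite /f !mul0r add0r powR1 mulr1 /binom_psum.
  rewrite big_ltn// mul1r expr0 big_nat_cond big1 ?addr0// => i /andP[/andP[i0 _] _].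
  by rewrite expr0n -[i == 0]negbK -lt0n i0 mulr0.
rewrite subr0 mulr1 => fE; rewrite !fctE fE /df normrN.
rewrite !normrM ger0_norm ?powR_ge0// (ger0_norm (ler0n _ _)).
have /andP[c0 c1] := binom_coef_itv n.
rewrite (ger0_norm c0) normrX -2!mulrA /K.
have ler_u : (t * - z + 1) `^ (g - 1) <= (1 - `|z|) `^ (g - 1).
  apply: ler_powRn; first by lra.
    by rewrite subr_gt0.
  by have := tz_le t t01; have := ler_norm (t * z); rewrite mulrN; lra.
apply: ler_pM; rewrite ?powR_ge0 ?mulr_ge0 ?exprn_ge0//.
apply: ler_pM; rewrite ?mulr_ge0 ?exprn_ge0 ?ler_piMr//.
rewrite -{2}(prednK n0) exprSr ler_wpM2r// lerXn2r ?nnegrE//.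
exact: tz_le.
Unshelve. all: by end_near. Qed.

End BinomialSeries.

(** * Positive semidefinite kernels and the inverse powers of a shifted squared distance *)

Section PositiveSemidefiniteKernels.
Variables (R : realType) (T : Type) (s : seq T).
Implicit Types (K L : T -> T -> R) (u : T -> R).

Definition psd K := forall a : T -> R,
  0 <= \sum_(k <- s) \sum_(l <- s) a k * a l * K k l.

Lemma psd_const1 : psd (fun _ _ => 1).
Proof.
move=> a; under eq_bigr do under eq_bigr do rewrite mulr1.
under eq_bigr do rewrite -mulr_sumr.
by rewrite -mulr_suml -expr2 sqr_ge0.
Qed.

Lemma psdD K L : psd K -> psd L -> psd (fun k l => K k l + L k l).
Proof.
move=> hK hL a; under eq_bigr do under eq_bigr do rewrite mulrDr.
by under eq_bigr do rewrite big_split; rewrite big_split addr_ge0.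
Qed.

Lemma psdZ (e : R) K : 0 <= e -> psd K -> psd (fun k l => e * K k l).
Proof.
move=> e0 hK a; under eq_bigr do under eq_bigr do rewrite mulrCA.
by under eq_bigr do rewrite -mulr_sumr; rewrite -mulr_sumr mulr_ge0.
Qed.

(** The factor [u] is absorbed into the test vector; this is the only case of the Schur product
    theorem needed below. *)
Lemma psd_rank1M u K : psd K -> psd (fun k l => u k * u l * K k l).
Proof.
move=> hK a; have := hK (fun k => a k * u k).
congr (0 <= _); apply: eq_bigr => k _; apply: eq_bigr => l _.
by ring.
Qed.

Lemma psd_sum (I : Type) (r : seq I) (K : I -> T -> T -> R) :
  (forall i, psd (K i)) -> psd (fun k l => \sum_(i <- r) K i k l).
Proof.
move=> hK; elim: r => [|i r IHr] a.
  by under eq_bigr do under eq_bigr do rewrite big_nil mulr0; rewrite !big1.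
under eq_bigr do under eq_bigr do rewrite big_cons.
exact: (psdD (hK i) IHr).
Qed.

Lemma psd_cvg (K : nat -> T -> T -> R) L : (forall n, psd (K n)) ->
  (forall k l, K n k l @[n --> \oo] --> L k l) -> psd L.
Proof.
move=> hK KL a.
apply: (@cvgr_to_ge _ \oo _ R
  (fun n => \sum_(k <- s) \sum_(l <- s) a k * a l * K n k l)).
  apply: cvg_big => [|k _]; first exact: add_continuous.
  apply: cvg_big => [|l _]; first exact: add_continuous.
  by apply: cvgM (KL k l); exact: cvg_cst.
by near=> n; exact: hK.
Unshelve. all: by end_near. Qed.

(* With w k = (x k)^2 + 2 d one has (x k - x l)^2 + d = w k * w l * (1 - z k l) / (2 d)
   for a psd kernel z with |z| < 1, so that the binomial series in z applies. *)
Lemma psd_inverse_power (x : T -> R) (d g : R) : 0 < d -> 0 < g < 1 ->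
  psd (fun k l => ((x k - x l) ^+ 2 + d) `^ (- g)).
Proof.
move=> d0 g01; pose v k := (x k ^+ 2 + 2 * d)^-1.
have w0 k : 0 < x k ^+ 2 + 2 * d by rewrite ltr_wpDl ?sqr_ge0 ?mulr_gt0.
have v0 k : 0 < v k by rewrite invr_gt0.
(* A nonnegative combination of three rank-one kernels. *)
pose z k l := (x k ^+ 2 * v k) * (x l ^+ 2 * v l) +
  (4 * d * (x k * v k * (x l * v l)) + 2 * d ^+ 2 * (v k * v l)).
have zE k l : (x k - x l) ^+ 2 + d =
    (2 * d)^-1 * ((v k)^-1 * (v l)^-1 * (1 - z k l)).
  rewrite /z /v; have := w0 k; have := w0 l.
  move=> /lt0r_neq0 wl /lt0r_neq0 wk; have d1 := lt0r_neq0 d0.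
  by field; rewrite d1 wl wk.
have z1 k l : `|z k l| < 1.
    have h1 : 0 < 1 - z k l.
    have : 0 < (x k - x l) ^+ 2 + d by rewrite ltr_wpDl// sqr_ge0.
    by rewrite zE !pmulr_rgt0 ?mulr_gt0 ?invr_gt0 ?mulr_gt0.
  (* Up to the factor [v k * v l] this is at least [(2 * d) ^+ 2 - 2 * d ^+ 2], even when
     [x k * x l] is negative. *)
  have h2 : 0 < 1 + z k l.
    have -> : 1 + z k l = v k * v l *
      ((x k ^+ 2 + 2 * d) * (x l ^+ 2 + 2 * d) + (x k * x l + 2 * d) ^+ 2 - 2 * d ^+ 2).
      rewrite /z /v; have := w0 k; have := w0 l.
      move=> /lt0r_neq0 wl /lt0r_neq0 wk.
      by field; rewrite wl wk.
    rewrite !mulr_gt0//; have := sqr_ge0 (x k); have := sqr_ge0 (x l).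
    have := sqr_ge0 (x k * x l + 2 * d); move: (_ ^+ 2) (_ ^+ 2) (_ ^+ 2) => A B C.
    nra.
  by rewrite ltr_norml; apply/andP; split; lra.
have zM L : psd L -> psd (fun k l => z k l * L k l).
  have d4 : 0 <= 4 * d by rewrite mulr_ge0// ltW.
  have d2 : 0 <= 2 * d ^+ 2 by rewrite mulr_ge0// sqr_ge0.
  move=> hL a; have := psdD (psd_rank1M (fun k => x k ^+ 2 * v k) hL)
    (psdD (psdZ d4 (psd_rank1M (fun k => x k * v k) hL))
          (psdZ d2 (psd_rank1M v hL))) a.
  congr (0 <= _); apply: eq_bigr => k _; apply: eq_bigr => l _.
  by rewrite /z; ring.
have zX n : psd (fun k l => z k l ^+ n).
  elim: n => [|n IHn] a; last first.
    by have := zM _ IHn a; under eq_bigr do under eq_bigr do rewrite -exprS.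
  by under eq_bigr do under eq_bigr do rewrite expr0; exact: psd_const1.
have z_pow : psd (fun k l => (1 - z k l) `^ (- g)).
  apply: (@psd_cvg (fun n k l => binom_psum g n (z k l))) => [n|k l].
    apply: psd_sum => i; apply: psdZ => //.
    by have /andP[] := binom_coef_itv g01 i.
  exact: cvg_binom_series.
(* Raising the factorization [zE] to the power [- g] only adds a positive constant and a diagonal
   rescaling to the kernel [z_pow]. *)
move=> a; have := psdZ (powR_ge0 (2 * d)^-1 (- g))
  (psd_rank1M (fun k => (v k)^-1 `^ (- g)) z_pow) a.
congr (0 <= _); apply: eq_bigr => k _; apply: eq_bigr => l _; congr (_ * _).
have h1 : 0 <= 1 - z k l.
  by rewrite subr_ge0 ltW//; have := z1 k l; rewrite ltr_norml => /andP[].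
have d2 : 0 <= (2 * d)^-1 by rewrite invr_ge0 mulr_ge0// ltW.
have v2 j : 0 <= (v j)^-1 by rewrite invr_ge0 ltW.
by rewrite zE !powRM ?mulr_ge0.
Qed.

End PositiveSemidefiniteKernels.

(** * Strict positivity for a small shift, from the dominant diagonal *)

Section Separated.
Variables (R : realType).

Lemma separated_inverse_power_gt0 (s : seq int) (a : int -> R) (g : R) (j : int) :
  uniq s -> j \in s -> a j != 0 -> 0 < g ->
  exists2 e : R, 0 < e & forall d, 0 < d < e ->
    0 < \sum_(k <- s) \sum_(l <- s) a k * a l * ((k%:~R - l%:~R) ^+ 2 + d) `^ (- g).
Proof.
move=> us js aj g0.
pose C := \sum_(k <- s) \sum_(l <- s) `|a k| * `|a l|.
pose A := \sum_(k <- s) a k ^+ 2.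
have A0 : 0 < A.
  rewrite /A (big_rem j)//= ltr_wpDr ?sumr_ge0// => [i _|]; first exact: sqr_ge0.
  by rewrite lt0r sqr_ge0 expf_neq0.
have C0 : 0 <= C by rewrite sumr_ge0// => k _; rewrite sumr_ge0// => l _; rewrite mulr_ge0.
have B0 : 0 < C / A + 1 by rewrite ltr_wpDl// divr_ge0// ltW.
exists ((C / A + 1) `^ (- g^-1)); first exact: powR_gt0.
move=> d /andP[d0 de].
have hd : C / A + 1 <= d `^ (- g).
  have -> : C / A + 1 = ((C / A + 1) `^ (- g^-1)) `^ (- g).
    by rewrite -powRrM mulrNN mulVf ?lt0r_neq0// powRr1// ltW.
  by apply: ler_powRn => //; rewrite ?oppr_le0 ltW.
suff : A * d `^ (- g) - C <=
    \sum_(k <- s) \sum_(l <- s) a k * a l * ((k%:~R - l%:~R) ^+ 2 + d) `^ (- g).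
  apply: lt_le_trans; rewrite subr_gt0.
  by rewrite mulrC -ltr_pdivrMr// (lt_le_trans _ hd)// ltrDl.
rewrite /A /C mulr_suml -sumrB big_seq [leRHS]big_seq; apply: ler_sum => k ks.
rewrite (bigD1_seq k)//= [leRHS](bigD1_seq k)//= subrr expr0n/= add0r -expr2.
rewrite opprD addrA lerD//; first by rewrite gerBl mulr_ge0.
rewrite -sumrN; apply: ler_sum => l lk.
have K0 : 0 <= ((k%:~R - l%:~R) ^+ 2 + d) `^ (- g) <= 1.
  rewrite powR_ge0/=; apply: (@le_trans _ _ (1 `^ (- g))); last by rewrite powR1.
  apply: ler_powRn => //; first by rewrite oppr_le0 ltW.
  rewrite ler_wpDr ?(ltW d0)// -intrB -rmorphXn /= ler1z.
  by rewrite -gtz0_ge1 exprn_even_gt0//= subr_eq0 eq_sym.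
have /andP[K1 K2] := K0.
rewrite lerNl; apply: le_trans (ler_norm _) _.
by rewrite normrN !normrM (ger0_norm K1) ler_piMr ?mulr_ge0.
Qed.

End Separated.

(** * Propagating signs from infinity through repeated integration *)

Section IntegrationFromInfinity.
Variable R : realType.

Lemma pos_of_decreasing_cvg0 (F dF : R -> R) (e : R) : 0 < e ->
  (forall x : R, 0 < x -> is_derive x 1 F (dF x)) ->
  (forall x : R, 0 < x -> dF x <= 0 /\ (x < e -> dF x < 0)) ->
  (forall h : R, 0 < h -> exists2 M : R, 0 < M & forall x : R, M <= x -> `|F x| <= h) ->
  forall x : R, 0 < x -> 0 <= F x /\ (x < e -> 0 < F x).
Proof.
move=> e0 dFE dF0 F0.
have F_ge0 x : 0 < x -> 0 <= F x.
  move=> x0; rewrite leNgt; apply/negP => Fx.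
  (* If [F x < 0], smallness at infinity forces a later value at least [F x / 2 > F x], against
     monotonicity. *)
  have h0 : 0 < - F x / 2 by lra.
  have [M M0 hM] := F0 _ h0.
  pose z := Num.max M x.
  have xz : x <= z by rewrite le_max lexx orbT.
  have [|t /andP[xt _]] := @MVT_derivable R F dF x z xz.
    by move=> t /andP[xt _]; apply: dFE; apply: lt_le_trans xt.
  have [dFt _] := dF0 t (lt_le_trans x0 xt).
  have := hM z; rewrite le_max lexx => /(_ isT); rewrite ler_norml => /andP[h _] h2.
  have : dF t * (z - x) <= 0 by rewrite mulr_le0_ge0 ?subr_ge0.
  by lra.
move=> x x0; split; [exact: F_ge0|move=> xe].
(* Up to the midpoint the derivative is still strictly negative, so [F x > F m >= 0]. *)
pose m := (x + e) / 2; have xm : x < m by rewrite /m; lra.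
have [|t /andP[xt tm] h] := @MVT_derivable R F dF x m (ltW xm).
  by move=> t /andP[xt _]; apply: dFE; apply: lt_le_trans xt.
have [_] := dF0 t (lt_le_trans x0 xt).
have te : t < e by apply: le_lt_trans tm _; rewrite /m; lra.
move=> /(_ te) dFt; have Fm := F_ge0 m (lt_trans x0 xm).
have : dF t * (m - x) < 0 by rewrite nmulr_rlt0// subr_gt0.
by rewrite -h; lra.
Qed.

Variables (I : Type) (r : seq I) (c y : I -> R).
Hypothesis y_ge0 : forall i, 0 <= y i.
Let G (p x : R) := \sum_(i <- r) c i * (y i + x) `^ p.

Lemma is_derive_shifted_powers (p x : R) : 0 < x ->
  is_derive x 1 (G p) (p * G (p - 1) x).
Proof.
move=> x0; rewrite /G mulr_sumr; apply: is_derive_big_sum => i.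
have h : 0 < x * 1 + y i by rewrite mulr1 ltr_pwDl.
have := is_derive_powR_affine p h; rewrite mulr1 mulr1.
rewrite (_ : (fun _ => _ `^ _) = (fun z => (y i + z) `^ p)); last first.
  by apply/funext => z; rewrite mulr1 addrC.
move=> dpow; rewrite (_ : (fun _ => _) = c i *: (fun z => (y i + z) `^ p))//.
by apply: is_derive_eq; rewrite /GRing.scale /= [y i + x]addrC; ring.
Qed.

Lemma cvg_shifted_powers_0 (p : R) : 0 < p ->
  G p x @[x --> 0^'+] --> \sum_(i <- r) c i * y i `^ p.
Proof.
move=> p0; apply: cvg_big => [|i _]; first exact: add_continuous.
apply: cvgM; first exact: cvg_cst.
have := y_ge0 i; rewrite le_eqVlt => /predU1P[<-|yi0].
  rewrite powR0 ?lt0r_neq0//.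
  by under eq_fun do rewrite add0r; exact: powR_cvg0.
apply: cvg_at_right_filter.
have -> : y i `^ p = (y i + 0) `^ p by rewrite addr0.
have h : 0 < 0 * 1 + y i by rewrite mulr1 add0r.
have [+ _] := is_derive_powR_affine p h.
rewrite (_ : (fun _ => _ `^ _) = (fun z => (y i + z) `^ p)); last first.
  by apply/funext => z; rewrite mulr1 addrC.
by move=> /derivable1_diffP/differentiable_continuous.
Qed.

Lemma shifted_powers_pos (n : nat) (p e : R) :
  (forall k, (k < n)%N -> \sum_(i <- r) c i * y i ^+ k = 0) ->
  n%:R - 1 < p < n%:R -> 0 < e ->
  (forall x : R, 0 < x -> 0 <= G (p - n%:R) x /\ (x < e -> 0 < G (p - n%:R) x)) ->
  forall j, (j <= n)%N -> forall x : R, 0 < x ->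
    0 <= (-1) ^+ j * G (p - n%:R + j%:R) x /\
    (x < e -> 0 < (-1) ^+ j * G (p - n%:R + j%:R) x).
Proof.
move=> c0 /andP[p1 p2] e0 Gbase j.
elim: j => [_ x|j IHj jn].
  by rewrite expr0 mul1r addr0; exact: Gbase.
have jn' : j.+1%:R <= n%:R :> R by rewrite ler_nat.
pose q := p - n%:R + j.+1%:R.
(* Since [p - n > -1], every exponent after the base one is positive, so each integration flips the
   sign exactly once. *)
have q0 : 0 < q by rewrite /q -natr1; have := ler0n R j; lra.
pose dF x := (-1) ^+ j.+1 * (q * G (q - 1) x).
have qE : q - 1 = p - n%:R + j%:R by rewrite /q -natr1; ring.
apply: (@pos_of_decreasing_cvg0 _ dF) => // [x x0|x x0|h h0].
- have dG := is_derive_shifted_powers q x0.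
  rewrite (_ : (fun _ => _) = (-1) ^+ j.+1 *: G q)//.
  exact: is_deriveZ.
- have [G1 G2] := IHj (ltnW jn) x x0.
  have dFE : dF x = - (q * ((-1) ^+ j * G (p - n%:R + j%:R) x)).
    by rewrite /dF qE exprS; ring.
  rewrite dFE oppr_le0 mulr_ge0 ?(ltW q0)//; split => // /G2 G3.
  by rewrite oppr_lt0 mulr_gt0.
- have qn : q < n%:R by rewrite /q; lra.
  have [M M0 hM] := shifted_powers_cvg0 y_ge0 c0 qn h0.
  by exists M => // x Mx; rewrite normrM normrX normrN1 expr1n mul1r; exact: hM.
Qed.

(** The signed sum is nonincreasing in the shift, its derivative being controlled by the level with
    exponent [p - 1]. Its limit at 0 is therefore at least its value at [e / 2], which is strictly
    positive. *)
Lemma conditional_powers_gt0 (n : nat) (p e : R) :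
  (forall k, (k < n.+1)%N -> \sum_(i <- r) c i * y i ^+ k = 0) ->
  n%:R < p < n.+1%:R -> 0 < e ->
  (forall x : R, 0 < x -> 0 <= G (p - n.+1%:R) x /\ (x < e -> 0 < G (p - n.+1%:R) x)) ->
  0 < (-1) ^+ n.+1 * \sum_(i <- r) c i * y i `^ p.
Proof.
move=> c0 /andP[p1 p2] e0 Gbase.
have pn : n.+1%:R - 1 < p < n.+1%:R by rewrite -natr1 addrK p1 natr1.
have p0 : 0 < p by apply: le_lt_trans p1.
have pos := shifted_powers_pos c0 pn e0 Gbase.
have e2 : 0 < e / 2 by rewrite divr_gt0.
have [_] := pos n.+1 (leqnn _) _ e2; rewrite subrK.
have e2e : e / 2 < e by lra.
move=> /(_ e2e); set F := (-1) ^+ n.+1 * _ => F_gt0.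
apply: lt_le_trans F_gt0 _.
apply: (@cvgr_to_ge _ 0^'+ _ R (fun x => (-1) ^+ n.+1 * G p x)).
  by apply: cvgM; [exact: cvg_cst|exact: cvg_shifted_powers_0].
near=> x.
have x0 : 0 < x by [].
have xe : x <= e / 2 by near: x; exact: nbhs_right_le.
have [|t /andP[xt _]] := @MVT_derivable R (G p) (fun x => p * G (p - 1) x) _ _ xe.
  by move=> t /andP[xt _]; apply: is_derive_shifted_powers; apply: lt_le_trans xt.
have [+ _] := pos n (leqnSn _) t (lt_le_trans x0 xt).
have -> : p - n.+1%:R + n%:R = p - 1 by rewrite -natr1; ring.
move=> Gt Gx; rewrite -subr_ge0 /F -mulrBr -opprB Gx exprS.
have -> : -1 * (-1) ^+ n * - (p * G (p - 1) t * (e / 2 - x)) =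
  p * ((-1) ^+ n * G (p - 1) t) * (e / 2 - x) by ring.
by rewrite mulr_ge0 ?subr_ge0// mulr_ge0// ltW.
Unshelve. all: by end_near. Qed.

End IntegrationFromInfinity.

(** * Autocorrelation sums and moments as finite double sums *)

Section FinitelySupportedSequences.
Variables (R : realType) (a : int -> R) (s : seq int).
Hypotheses (us : uniq s) (a0 : forall j, j \notin s -> a j = 0).

Lemma fsum_setT (f : int -> R) (r : seq int) : uniq r ->
  (forall j, j \notin r -> f j = 0) ->
  \sum_(j \in [set: int]) f j = \sum_(j <- r) f j.
Proof.
move=> ur f0; rewrite (fsbigE r)//; last by move=> j _; exact: f0.
by apply: eq_bigl => j; rewrite in_setT.
Qed.

Lemma momentE n : moment a n = \sum_(k <- s) a k * k%:~R ^+ n.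
Proof. by apply: fsum_setT => // j /a0 ->; rewrite mul0r. Qed.

Lemma autocorrelationE j : autocorrelation a j =
  \sum_(k <- s) \sum_(l <- s) if k - l == j then a k * a l else 0.
Proof.
rewrite /autocorrelation (fsbigE [seq p <- [seq (k, l) | k <- s, l <- s] | p.1 - p.2 == j]).
- rewrite big_filter_cond big_mkcond big_allpairs.
  apply: eq_bigr => k _; apply: eq_bigr => l _ /=; set p := (k, l).
  have -> : (p \in [set p : int * int | p.1 - p.2 = j]) = (p.1 - p.2 == j).
    by apply/idP/eqP; rewrite inE.
  by rewrite andbb.
- by rewrite filter_uniq// allpairs_uniq// => -[? ?] [? ?].
- by move=> p /=; rewrite mem_filter => /andP[/eqP].
- move=> [k l] /= /eqP kl; rewrite mem_filter /= kl /=.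
  have [ks|/a0 ->] := boolP (k \in s); last by rewrite mul0r.
  have [ls|/a0 ->] := boolP (l \in s); last by rewrite mulr0.
  by rewrite allpairs_f.
Qed.

Lemma sum_autocorrelation (w : int -> R) :
  \sum_(j \in [set: int]) autocorrelation a j * w j =
  \sum_(k <- s) \sum_(l <- s) a k * a l * w (k - l).
Proof.
(* Removing repetitions lets each pair [(k, l)] be counted at exactly one index [j = k - l]. *)
pose t := undup [seq k - l | k <- s, l <- s].
have diff_in k l : k \in s -> l \in s -> k - l \in [seq k - l | k <- s, l <- s].
  by move=> ks ls; apply: allpairs_f.
rewrite (@fsum_setT _ t) ?undup_uniq// => [|j].
  under eq_bigr do rewrite autocorrelationE mulr_suml.
  rewrite exchange_big; apply: eq_big_seq => k ks.
  under eq_bigr do rewrite mulr_suml.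
  rewrite exchange_big; apply: eq_big_seq => l ls.
  rewrite (bigD1_seq (k - l)) ?undup_uniq ?mem_undup ?diff_in//= eqxx.
  by rewrite big1 ?addr0// => j /negPf; rewrite eq_sym => ->; rewrite mul0r.
rewrite mem_undup autocorrelationE => jt.
rewrite big_seq big1 ?mul0r// => k ks; rewrite big_seq big1// => l ls.
by case: eqP jt => // <-; rewrite diff_in.
Qed.

(** The binomial expansion of [(k - l) ^ (2 * i)] splits the double sum into products of moments of
    orders [2 * i - j] and [j]. One of the two orders is at most [i], hence at most [n]. *)
Lemma autocorrelation_moment0 n i :
  (forall k, (k <= n)%N -> moment a k = 0) -> (i <= n)%N ->
  \sum_(k <- s) \sum_(l <- s) a k * a l * ((k%:~R - l%:~R) ^+ 2) ^+ i = 0.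
Proof.
move=> m0 i_n; under eq_bigr do under eq_bigr do rewrite -exprM exprBn mulr_sumr.
under eq_bigr do rewrite exchange_big; rewrite exchange_big.
rewrite big1// => j _.
transitivity ((-1) ^+ j * moment a (2 * i - j) * moment a j *+ 'C(2 * i, j)).
  rewrite !momentE -mulrA mulr_suml mulr_sumr -sumrMnl; apply: eq_bigr => k _.
  rewrite 2!mulr_sumr -sumrMnl; apply: eq_bigr => l _.
  by rewrite mulrnAr; congr (_ *+ _); ring.
have [ji|ij] := leqP j i; first by rewrite (m0 j) ?mulr0 ?mul0rn// (leq_trans ji).
by rewrite (m0 (2 * i - j)%N) ?mulr0 ?mul0r ?mul0rn//; lia.
Qed.

End FinitelySupportedSequences.

(** * Assembly over the list of index pairs *)

Theorem proposition2p6 (R : realType) (D : nat) (s : R) (a : int -> R) (M : nat)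
    (s_gt0 : 0 < s) (s_lt2 : s < 2)
    (a_fin : finitely_supported a) (a_neq0 : exists j : int, a j != 0)
    (a_sum0 : \sum_(j \in [set: int]) a j = 0)
    (a_order : has_order a M) (ltDM : (D < M)%N) :
  \sum_(j \in [set: int])
      autocorrelation a j * `|j%:~R : R| `^ (2 * D%:R + s) <> 0
  /\
  (-1) ^+ D * (\sum_(j \in [set: int])
      autocorrelation a j * `|j%:~R : R| `^ (2 * D%:R + s)) < 0.
Proof.
set Q := \sum_(j \in _) _.
suff Q_lt0 : (-1) ^+ D * Q < 0.
  by split=> // Q0; move: Q_lt0; rewrite Q0 mulr0 ltxx.
have [S [uS S0]] : exists S : seq int, uniq S /\ forall j, j \notin S -> a j = 0.
  move: a_fin => /finite_seqP[S SE]; exists (undup S); split; first exact: undup_uniq.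
  move=> j; rewrite mem_undup => jS; apply/eqP; apply: contraNT jS => aj.
  by have : [set j | a j != 0] j by []; rewrite SE.
have [j aj] := a_neq0.
have jS : j \in S by apply: contraNT aj => /S0 ->.
pose c (p : int * int) := a p.1 * a p.2.
pose y (p : int * int) : R := (p.1%:~R - p.2%:~R) ^+ 2.
pose r := [seq (k, l) | k <- S, l <- S].
have sumE (w : R -> R) : \sum_(k <- S) \sum_(l <- S) a k * a l * w ((k%:~R - l%:~R) ^+ 2) =
    \sum_(p <- r) c p * w (y p) by rewrite big_allpairs.
(* Half of the exponent, because the kernel is expressed through the squared differences [y]. *)
pose b := D%:R + s / 2.
have QE : Q = \sum_(p <- r) c p * y p `^ b.
  rewrite /Q (sum_autocorrelation uS S0) -(sumE (fun u => u `^ b)).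
  apply: eq_bigr => k _; apply: eq_bigr => l _; congr (_ * _).
  have -> : 2 * D%:R + s = 2 * b by rewrite /b; field.
  by rewrite powRrM powR_mulrn// intrB real_normK ?num_real.
have c0 k : (k < D.+1)%N -> \sum_(p <- r) c p * y p ^+ k = 0.
  rewrite ltnS => kD; rewrite -(sumE (fun u => u ^+ k)).
  apply: (autocorrelation_moment0 uS S0 _ kD) => i iD.
  by case: a_order => m0 _; apply: m0; apply: leq_ltn_trans ltDM.
have y0 p : 0 <= y p by exact: sqr_ge0.
have bD : D%:R < b < D.+1%:R by rewrite /b -(natr1 D); apply/andP; split; lra.
(* Lowering [b] by [D + 1] gives [- g]; the condition [0 < s < 2] is what puts [g] in the range of
   the kernel lemma. *)
pose g := 1 - s / 2; have g01 : 0 < g < 1 by rewrite /g; apply/andP; split; lra.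
have gE : b - D.+1%:R = - g by rewrite /b /g -(natr1 D); ring.
have [e e0 he] := separated_inverse_power_gt0 uS jS aj (proj1 (andP g01)).
suff : 0 < (-1) ^+ D.+1 * Q by rewrite exprS mulN1r mulNr oppr_gt0.
rewrite QE; apply: (conditional_powers_gt0 y0 c0 bD e0) => x x0.
rewrite gE -(sumE (fun u => (u + x) `^ (- g))); split; last first.
  by move=> xe; apply: he; rewrite x0.
exact: (psd_inverse_power S (fun k : int => k%:~R) x0 g01 a).
Qed.
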